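(* Let $\theta\ge0$. If $1<q_2\le q_1<\infty$ and $1<p<\infty$, then $$W(L^{p),\theta},L^{q_1),\theta})\subset W(L^{p),\theta},L^{q_2),\theta}).$$
   Context: $\Omega$ is a locally compact Hausdorff space with a finite Borel measure $\mu$, and $Q\subset\Omega$ is a fixed compact subset with nonempty interior. To make sense of translates, $\Omega$ is a locally compact Borel subset (possibly all) of a locally compact Hausdorff abelian group $G$, written additively; for $x\in\Omega$, $Q+x=\{t+x:t\in Q\}$ and $\chi_{Q+x}$ is the characteristic function of $(Q+x)\cap\Omega$ on $\Omega$. Functions are identified when equal $\mu$-a.e. Generalized grand Lebesgue space: for $1<p<\infty$, $\theta\ge0$, $L^{p),\theta}=L^{p),\theta}(\mu)$ is the space of measurable $f$ with $\|f\|_{p),\theta}=\sup_{0<\varepsilon\le p-1}\varepsilon^{\frac{\theta}{p-\varepsilon}}\left(\int_\Omega|f|^{p-\varepsilon}d\mu\right)^{\frac1{p-\varepsilon}}<\infty$. $(L^{p),\theta})_{loc}$ is the space of measurable $f$ with $f\chi_K\in L^{p),\theta}$ for every compact $K\subset\Omega$. Grand Wiener amalgam space: for $1<p,q<\infty$, $W(L^{p),\theta},L^{q),\theta})$ is the space of $f\in(L^{p),\theta})_{loc}$ such that $F_f^{p),\theta}(x)=\|f\chi_{Q+x}\|_{p),\theta}$ lies in $L^{q),\theta}$, with norm $\|F_f^{p),\theta}\|_{q),\theta}$. *)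

(* Defs.v *)
From HB Require Import structures.
From mathcomp Require Import all_boot all_order all_algebra.
From mathcomp Require Import all_classical all_reals all_analysis.
From mathcomp Require Import measurable_realfun.
From mathcomp Require Import complex.

Set Implicit Arguments.
Unset Strict Implicit.
Unset Printing Implicit Defensive.

Import Order.TTheory GRing.Theory Num.Theory.
Import numFieldNormedType.Exports.

Local Open Scope classical_set_scope.
Local Open Scope ring_scope.
Local Open Scope complex_scope.

(* The subset Omega of G as a space in its own right, with the topology
   induced by G and the Borel sigma-algebra of that topology.  Measurable types
   are pointed in the library; the base point omega0 is used for nothing else. *)
Definition borel_subtype (G : topologicalType) (Omega : set G)
    (omega0 : Omega) : Type :=
  set_type Omega.

Section borel_subtype_instances.
Variables (G : topologicalType) (Omega : set G) (omega0 : Omega).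
Local Notation T := (borel_subtype omega0).

HB.instance Definition _ := Topological.copy T (set_type Omega).
HB.instance Definition _ := isPointed.Build T omega0.
HB.instance Definition _ := @isMeasurable.Build (sigma_display (@open T)) T
  <<s (@open T) >> (@sigma_algebra0 _ setT _) (@sigma_algebraC T _)
  (@sigma_algebra_bigcup _ setT _).

End borel_subtype_instances.

Section grand_lebesgue.
Context d (T : measurableType d) (R : realType).
Variables (mu : {measure set T -> \bar R}) (p theta : R).

Definition grand_norm (g : T -> \bar R) : \bar R :=
  ereal_sup [set ((eps `^ (theta / (p - eps)))%:E
                    * 'N[mu]_((p - eps)%:E)[g])%E
            | eps in [set eps : R | 0 < eps <= p - 1]].

(* For extended-real functions, such as x |-> ||f chi_(Q+x)||, which may be
   infinite at some points when (Q+x) /\ Omega is not compact. *)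
Definition grand_lebesgue : set (T -> \bar R) :=
  [set g : T -> \bar R | measurable_fun setT g /\ (grand_norm g < +oo)%E].

Definition cmeasurable (f : T -> R[i]) : Prop :=
  measurable_fun setT (fun x => complex.Re (f x)) /\
  measurable_fun setT (fun x => complex.Im (f x)).

Definition cgrand_norm (f : T -> R[i]) : \bar R :=
  grand_norm (fun x => (Normc.normc (f x))%:E).

(* The scalars are complex; the spaces of real functions are the real-valued
   members.  Here and below, membership of a measurable f depends only on its
   mu-a.e. class, so the spaces are given by their measurable representatives. *)
Definition cgrand_lebesgue : set (T -> R[i]) :=
  [set f : T -> R[i] | cmeasurable f /\ (cgrand_norm f < +oo)%E].

End grand_lebesgue.

Section grand_wiener_amalgam.
Context (R : realType) (G : topologicalZmodType) (Omega : set G)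
  (omega0 : Omega).
Local Notation T := (borel_subtype omega0).
Variables (mu : {measure set T -> \bar R}) (Q : set T).

(* (Q + x) /\ Omega, as a subset of Omega: the sum is taken in G *)
Definition translate (x : T) : set T :=
  [set y : T | exists2 t : T, Q t & set_val y = set_val t + set_val x].

Definition cgrand_lebesgue_loc (p theta : R) : set (T -> R[i]) :=
  [set f : T -> R[i] | cmeasurable f /\
    forall K : set T, compact K -> cgrand_lebesgue mu p theta (f \* \1_K)].

Definition control_function (p theta : R) (f : T -> R[i]) (x : T) : \bar R :=
  cgrand_norm mu p theta (f \* \1_(translate x)).

Definition grand_amalgam (p q theta : R) : set (T -> R[i]) :=
  [set f : T -> R[i] | cgrand_lebesgue_loc p theta f /\
           grand_lebesgue mu q theta (control_function p theta f)].

End grand_wiener_amalgam.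

(* Main.v *)
Require Import Defs.
From HB Require Import structures.
From mathcomp Require Import all_boot all_order all_algebra.
From mathcomp Require Import all_classical all_reals all_analysis.
From mathcomp Require Import measurable_realfun.
From mathcomp Require Import complex.
From mathcomp Require Import lra.

(** Both amalgam spaces impose the same local condition on f, so the inclusion
is a statement about the control function F alone: on a finite measure space
the grand Lebesgue spaces decrease in the exponent.

To see this, compare the two suprema at the same parameter eps <= q2 - 1, with
exponents a = q2 - eps <= b = q1 - eps, and let s = 1/a - 1/b, which lies in
[0, 1] because a >= 1.  Hoelder's inequality against the constant 1
([Lnorm_le]) gives N_a[F] <= mu(T)^s N_b[F], and the weights satisfy
eps^(theta/a) = eps^(theta s) eps^(theta/b).  As s stays in [0, 1], the two
extra factors are bounded uniformly in eps, by max(1, mu(T)) and q2^theta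
([grand_norm_lty]).

The control function takes values in [0, +oo], while Hoelder's inequality is
used for real functions.  The gap is bridged by the fact that a function with
a finite Lebesgue norm is finite almost everywhere. *)

Set Implicit Arguments.
Unset Strict Implicit.
Unset Printing Implicit Defensive.

Import Order.TTheory GRing.Theory Num.Theory.
Import numFieldNormedType.Exports.

Local Open Scope classical_set_scope.
Local Open Scope ring_scope.

Section finite_measure_inclusion.
Context d (T : measurableType d) (R : realType).
Implicit Type g : T -> \bar R.
Local Open Scope ereal_scope.

Lemma Lnorm_fine (mu : {measure set T -> \bar R}) (r : R) g :
  measurable_fun setT g -> {ae mu, forall x, g x \is a fin_num} ->
  'N[mu]_(r%:E)[g] = 'N[mu]_(r%:E)[EFin \o (fine \o g)].
Proof.
move=> mg gfin; rewrite unlock; congr (_ `^ _).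
apply: ae_eq_integral => //.
- apply: (measurableT_comp (measurable_poweR r)).
  exact: measurableT_comp.
- apply: (measurableT_comp (measurable_poweR r)).
  apply: measurableT_comp => //; apply/measurable_EFinP.
  exact: measurableT_comp.
- by apply: filterS gfin => x gx _; rewrite -[in LHS](fineK gx).
Qed.

Lemma Lnorm_lty_fin (mu : {measure set T -> \bar R}) (r : R) g :
  (0 < r)%R -> measurable_fun setT g -> 'N[mu]_(r%:E)[g] < +oo ->
  {ae mu, forall x, g x \is a fin_num}.
Proof.
move=> r0 mg glty.
have ig : mu.-integrable setT (fun x => `|g x| `^ r).
  apply/integrableP; split.
    by apply: (measurableT_comp (measurable_poweR r)); exact: measurableT_comp.
  under eq_integral do rewrite gee0_abs ?poweR_ge0//.
  by rewrite -poweR_Lnorm ?gt_eqF// poweR_lty.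
apply: filterS (integrable_ae measurableT ig) => x /(_ I).
by rewrite fin_num_abs; case: (g x) => [s|//|//] /=; rewrite ?ltry ?poweRyr ?gt_eqF.
Qed.

(** Hoelder's inequality for |f|^a and the constant 1, with exponents b/a and
its conjugate 1/(1 - a/b); taking the power 1/a of both sides turns the
resulting factor mu(T)^(1 - a/b) into mu(T)^(1/a - 1/b). *)
Lemma Lnorm_le_real (mu : {measure set T -> \bar R}) (a b : R) (f : T -> R) :
  (0 < a)%R -> (a <= b)%R -> measurable_fun setT f ->
  'N[mu]_(a%:E)[EFin \o f] <=
    mu setT `^ (a^-1 - b^-1) * 'N[mu]_(b%:E)[EFin \o f].
Proof.
move=> a0; rewrite le_eqVlt => /predU1P[<- _|ab mf].
  by rewrite subrr poweRe0 mul1e.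
have b0 : (0 < b)%R by exact: lt_trans ab.
have p0 : (0 < b / a)%R by rewrite divr_gt0.
have c0 : (0 < 1 - a / b)%R by rewrite subr_gt0 ltr_pdivrMr// mul1r.
have pq : ((b / a)^-1 + (1 - a / b)^-1^-1 = 1)%R.
  by rewrite invrK invf_div addrC subrK.
pose h x := (`|f x| `^ a)%R.
have mh : measurable_fun setT h.
  apply: (@measurableT_comp _ _ _ _ _ _ (@powR R ^~ a)) => //.
  exact: measurableT_comp.
have q0 : (0 < (1 - a / b)^-1)%R by rewrite invr_gt0.
have hoel := hoelder mu mh (measurable_cst (1%R : R)) p0 q0 pq.
have normr_h x : `|h x|%R = h x by rewrite ger0_norm ?powR_ge0.
have lhsE : 'N[mu]_1[EFin \o (h \* cst 1)%R] = \int[mu]_x (`|(f x)%:E| `^ a).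
  rewrite Lnorm1; apply: eq_integral => x _.
  by rewrite /= mulr1 normr_h.
have normE : 'N[mu]_((b / a)%:E)[EFin \o h] = 'N[mu]_(b%:E)[EFin \o f] `^ a.
  rewrite unlock invf_div -poweRrM [in RHS]mulrC; congr (_ `^ _).
  apply: eq_integral => x _.
  by rewrite /= normr_h -powRrM mulrC divfK ?gt_eqF.
move: hoel; rewrite lhsE normE Lnorm_cst1 invrK => hoel.
have -> : 'N[mu]_(a%:E)[EFin \o f] =
    (\int[mu]_x (`|(f x)%:E| `^ a)) `^ a^-1 by rewrite unlock.
apply: (le_trans (gt0_ler_poweR _ _ _ hoel)).
- by rewrite invr_ge0 (ltW a0).
- rewrite in_itv/= leey andbT.
  by apply: integral_ge0 => x _; rewrite lee_fin powR_ge0.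
- by rewrite in_itv/= leey andbT; apply: mule_ge0; exact: poweR_ge0.
rewrite poweRM; [|exact: poweR_ge0..]; rewrite -!poweRrM mulfV ?gt_eqF// poweRe1 ?Lnorm_ge0//.
by rewrite muleC mulrBl mul1r mulrAC mulfV ?gt_eqF// mul1r.
Qed.

Lemma Lnorm_le (mu : {measure set T -> \bar R}) (a b : R) g :
  (0 < a)%R -> (a <= b)%R -> measurable_fun setT g ->
  'N[mu]_(b%:E)[g] < +oo ->
  'N[mu]_(a%:E)[g] <= mu setT `^ (a^-1 - b^-1) * 'N[mu]_(b%:E)[g].
Proof.
move=> a0 ab mg glty.
have gfin := Lnorm_lty_fin (lt_le_trans a0 ab) mg glty.
rewrite !(Lnorm_fine _ mg gfin); apply: Lnorm_le_real => //.
exact: measurableT_comp.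
Qed.

(** The bound is uniform in the exponent s, which is why it is M and not M^s;
taking 1 <= M covers bases x on both sides of 1. *)
Lemma powR_le_bound (x M s : R) :
  (0 <= x -> x <= M -> 1 <= M -> 0 <= s -> s <= 1 -> x `^ s <= M)%R.
Proof.
move=> x0 xM M1 s0 s1.
apply: (@le_trans _ _ (M `^ s)%R); last exact: ler1_powR.
by apply: ge0_ler_powR; rewrite ?nnegrE// (le_trans x0).
Qed.

(** The constant q2^theta * max(1, mu(T)) bounds the ratio of the two norms:
it has to be independent of eps, since both norms are suprema over eps. *)
Lemma grand_norm_lty (mu : {finite_measure set T -> \bar R})
    (q1 q2 theta : R) g :
  (0 <= theta)%R -> (1 < q2)%R -> (q2 <= q1)%R -> measurable_fun setT g ->
  grand_norm mu q1 theta g < +oo -> grand_norm mu q2 theta g < +oo.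
Proof.
move=> theta0 q2_gt1 q21 mg glty.
pose M : R := Num.max 1%R (fine (mu setT)).
have muM : mu setT = (fine (mu setT))%:E by rewrite fineK// fin_num_measure.
have mu0 : (0 <= fine (mu setT))%R by rewrite fine_ge0.
have M1 : (1 <= M)%R by rewrite le_max lexx.
have q2_ge1 : (1 <= q2)%R by exact: ltW.
suff bound : grand_norm mu q2 theta g <=
    (q2 `^ theta * M)%:E * grand_norm mu q1 theta g.
  have C0 : (0 < q2 `^ theta * M)%R.
    by rewrite mulr_gt0 ?powR_gt0 ?(lt_le_trans ltr01).
  apply: (le_lt_trans bound); rewrite lte_mul_pinfty//.
  by rewrite lee_fin ltW.
apply: ge_ereal_sup => _ [eps /= /andP[eps0 epsq2] <-].
set a := (q2 - eps)%R; set b := (q1 - eps)%R.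
have a1 : (1 <= a)%R by rewrite /a; lra.
have ab : (a <= b)%R by rewrite /a /b; lra.
have a0 : (0 < a)%R by lra.
have b0 : (0 < b)%R by lra.
set s := (a^-1 - b^-1)%R.
have s0 : (0 <= s)%R by rewrite subr_ge0 lef_pV2 ?posrE.
have s1 : (s <= 1)%R.
  have : (a^-1 <= 1)%R by rewrite invf_le1.
  have : (0 < b^-1)%R by rewrite invr_gt0.
  by rewrite /s; lra.
have in1 : (eps `^ (theta / b))%:E * 'N[mu]_(b%:E)[g] <=
    grand_norm mu q1 theta g.
  by apply: ereal_sup_ubound; exists eps => //=; rewrite eps0/=; lra.
(* The weight is positive, so a finite supremum forces every norm of index
   b = q1 - eps to be finite. *)
have glty_b : 'N[mu]_(b%:E)[g] < +oo.
  rewrite ltey; apply/eqP => gy; move: (le_lt_trans in1 glty).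
  by rewrite gy gt0_muley ?ltxx// lte_fin powR_gt0.
have epsE : (eps `^ (theta / a) <= q2 `^ theta * eps `^ (theta / b))%R.
  have -> : (theta / a = theta * s + theta / b)%R by rewrite -mulrDr subrK.
  rewrite powRD ?(gt_eqF eps0) ?implybT// ler_wpM2r ?powR_ge0//.
  apply: (@le_trans _ _ (q2 `^ (theta * s))%R).
    apply: ge0_ler_powR; rewrite ?nnegrE ?mulr_ge0 ?(ltW eps0)//.
      by rewrite (le_trans ler01).
    lra.
  by apply: ler_powR => //; rewrite ler_piMr.
have muE : mu setT `^ s <= M%:E.
  rewrite muM poweR_EFin lee_fin; apply: powR_le_bound => //.
  by rewrite le_max lexx orbT.
apply: (@le_trans _ _ ((q2 `^ theta * eps `^ (theta / b))%:E *
                       (M%:E * 'N[mu]_(b%:E)[g]))).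
  apply: lee_pmul; rewrite ?lee_fin ?powR_ge0 ?Lnorm_ge0//.
  apply: (le_trans (Lnorm_le _ ab mg glty_b)) => //.
  by rewrite lee_wpmul2r ?Lnorm_ge0.
rewrite !EFinM muleACA lee_wpmul2l// -EFinM lee_fin mulr_ge0 ?powR_ge0//.
by rewrite (le_trans ler01).
Qed.

End finite_measure_inclusion.

Theorem proposition3 (R : realType) (G : topologicalZmodType)
    (Omega : set G) (omega0 : Omega)
    (mu : {finite_measure set (borel_subtype omega0) -> \bar R})
    (Q : set (borel_subtype omega0)) (p q1 q2 theta : R) :
  hausdorff_space G -> locally_compact [set: G] ->
  <<s (@open G) >> Omega ->
  locally_compact [set: borel_subtype omega0] ->
  compact Q -> Q° !=set0 ->
  0 <= theta -> 1 < q2 -> q2 <= q1 -> 1 < p ->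
  grand_amalgam mu Q p q1 theta `<=` grand_amalgam mu Q p q2 theta.
Proof.
move=> _ _ _ _ _ _ theta0 q2_gt1 q21 _ f [floc [mF Flty]].
by split=> //; split=> //; exact: (grand_norm_lty theta0 q2_gt1 q21 mF Flty).
Qed.
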